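(* Let $\mathfrak{g}$ be a finite-dimensional complex Lie algebra, $\mathfrak{a}$ an abelian ideal of $\mathfrak{g}$, and suppose there is a Lie subalgebra $\mathfrak{q}$ of $\mathfrak{g}$ such that $\mathfrak{g}=\mathfrak{q}\oplus\mathfrak{a}$ (direct sum of vector spaces). For $\ell\in\mathfrak{g}^*$ let $\ell_0=\ell_{|\mathfrak{a}}$ and $\mathfrak{q}(\ell_0)=\{x\in\mathfrak{q}:\langle\ell_0,[x,a]\rangle=0\text{ for all }a\in\mathfrak{a}\}$, and let $\Omega$ be the set of $\ell\in\mathfrak{g}^*$ such that $\operatorname{codim}_{\mathfrak{a}^*}(\mathfrak{g}.\ell_0)=\operatorname{ind}(\mathfrak{g},\mathfrak{a})$. The following assertions are equivalent: (1) $\operatorname{ind}(\mathfrak{g})+\dim\mathfrak{a}=\dim(\mathfrak{g}/\mathfrak{a})+2\operatorname{ind}(\mathfrak{g},\mathfrak{a})$. (2) For every $\ell\in\Omega$, the Lie algebra $\mathfrak{q}(\ell_0)$ is abelian.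
   Context: For $\ell\in\mathfrak{g}^*$, $\mathfrak{g}^\ell=\{x\in\mathfrak{g}:\langle\ell,[x,y]\rangle=0\text{ for all }y\in\mathfrak{g}\}$, and the index of $\mathfrak{g}$ is $\operatorname{ind}(\mathfrak{g})=\min_{\ell\in\mathfrak{g}^*}\dim\mathfrak{g}^\ell$. $\mathfrak{g}$ acts on $\mathfrak{a}^*$ by $\langle x.f,a\rangle=-\langle f,[x,a]\rangle$; for $f\in\mathfrak{a}^*$, $\mathfrak{g}.f=\{x.f:x\in\mathfrak{g}\}\subset\mathfrak{a}^*$, and $\operatorname{ind}(\mathfrak{g},\mathfrak{a})=\min_{f\in\mathfrak{a}^*}\operatorname{codim}_{\mathfrak{a}^*}(\mathfrak{g}.f)$. *)

(* Defs.v *)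
From HB Require Import structures.
From mathcomp Require Import all_boot all_order all_algebra.
From mathcomp Require Import boolp reals.
From mathcomp Require Import complex.

Set Implicit Arguments.
Unset Strict Implicit.
Unset Printing Implicit Defensive.

Import GRing.Theory.
Local Open Scope ring_scope.

HB.mixin Record Vector_isLieAlgebra (K : fieldType) V of Vector K V := {
  lieb : V -> V -> V;
  lieb_linearl : forall y, linear (fun x => lieb x y);
  lieb_linearr : forall x, linear (lieb x);
  liebb : forall x, lieb x x = 0;
  jacobi : forall x y z,
    lieb x (lieb y z) + lieb y (lieb z x) + lieb z (lieb x y) = 0
}.

#[short(type="lieAlgType")]
HB.structure Definition LieAlgebra (K : fieldType) :=
  { V of Vector_isLieAlgebra K V & Vector K V }.

Notation "[ 'lie' x , y ]" := (lieb x y)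
  (at level 0, x, y at level 99, format "[ 'lie'  x ,  y ]") : ring_scope.

Section NatMin.
Variables (V : nmodType) (F : V -> nat).

Fact min_val_subproof : exists n, `[< exists v, F v = n >].
Proof. by exists (F 0); apply/asboolP; exists 0. Qed.

Definition min_val : nat := ex_minn min_val_subproof.

Lemma min_valP : (exists v, F v = min_val) /\ (forall v, min_val <= F v)%N.
Proof.
rewrite /min_val; case: ex_minnP => m /asboolP Hm min_m; split=> // v.
by apply: min_m; apply/asboolP; exists v.
Qed.

End NatMin.

Definition dual (K : fieldType) (V : vectType K) := 'Hom(V, K^o).

(* Also serves as dim (V / U): quotients of vector spaces are not available
   in the library. *)
Definition codimv (K : fieldType) (V : vectType K) (U : {vspace V}) : nat :=
  (\dim {:V} - \dim U)%N.

Lemma linfun_linearE (K : fieldType) (V W : vectType K) (f : V -> W) :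
  linear f -> linfun f =1 f.
Proof.
move=> lin_f; pose m := GRing.isLinear.Build K V W *:%R f lin_f.
pose h : {linear V -> W} := HB.pack f m.
exact: (lfunE h).
Qed.

Section LieAlgebraTheory.
Variables (K : fieldType) (g : lieAlgType K).
Implicit Types (x y : g) (a q U : {vspace g}) (l : dual g).

Definition is_subalg U := forall x y, x \in U -> y \in U -> [lie x, y] \in U.
Definition is_ideal U := forall x y, y \in U -> [lie x, y] \in U.
Definition is_abelian U := forall x y, x \in U -> y \in U -> [lie x, y] = 0.

Definition kirillov l : 'Hom(g, dual g) :=
  linfun (fun x => linfun (fun y => l [lie x, y] : K^o)).

Definition lie_stab l : {vspace g} := lker (kirillov l).

Definition lie_index : nat := min_val (fun l => \dim (lie_stab l)).

(* The action <x.f, u> = - <f, [x, u]> of g on the dual of a. For an ideal a,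
   the projection vsproj a merely retypes [x, u], which is already in a. *)
Definition coact a (f : dual (subvs_of a)) x : dual (subvs_of a) :=
  linfun (fun u => - f (vsproj a [lie x, vsval u]) : K^o).

Definition coorbit a (f : dual (subvs_of a)) : {vspace dual (subvs_of a)} :=
  limg (linfun (coact f)).

Definition rel_index a : nat :=
  min_val (fun f : dual (subvs_of a) => codimv (coorbit f)).

Definition dual_restr a l : dual (subvs_of a) := (l \o linfun (@vsval _ _ a))%VF.

(* q(f) = {x in q | <f, [x, u]> = 0 for all u in a}. *)
Definition isotropy q a (f : dual (subvs_of a)) : {vspace g} :=
  (q :&: lker (linfun (coact f)))%VS.

Lemma kirillovE l x y : kirillov l x y = l [lie x, y].
Proof.
have E z w : linfun (fun y => l [lie z, y] : K^o) w = l [lie z, w].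
  by apply: linfun_linearE => k u v; rewrite lieb_linearr linearP.
rewrite /kirillov linfun_linearE ?E// => k u v; apply/lfunP=> w.
by rewrite add_lfunE scale_lfunE !E lieb_linearl linearP.
Qed.

Lemma mem_lie_stab l x : x \in lie_stab l <-> forall y, l [lie x, y] = 0.
Proof.
rewrite memv_ker; split=> [/eqP E y|E]; first by rewrite -kirillovE E zero_lfunE.
by apply/eqP/lfunP=> y; rewrite kirillovE E zero_lfunE.
Qed.

Lemma coactE a (f : dual (subvs_of a)) x u :
  coact f x u = - f (vsproj a [lie x, vsval u]).
Proof.
rewrite linfun_linearE // => k v w.
by rewrite linearP lieb_linearr !linearP.
Qed.

Lemma coact_is_linear a (f : dual (subvs_of a)) : linear (coact f).
Proof.
move=> k x y; apply/lfunP=> u; rewrite add_lfunE scale_lfunE !coactE.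
by rewrite lieb_linearl !linearP.
Qed.

HB.instance Definition _ a (f : dual (subvs_of a)) :=
  GRing.isLinear.Build _ _ _ _ (coact f) (coact_is_linear f).

Lemma mem_coorbit a (f h : dual (subvs_of a)) :
  h \in coorbit f <-> exists x, h = coact f x.
Proof.
split=> [/memv_imgP [x _ ->]|[x ->]]; first by exists x; rewrite lfunE.
by rewrite -lfunE memv_img ?memvf.
Qed.

Lemma dual_restrE a l u : dual_restr a l u = l (vsval u).
Proof. by rewrite comp_lfunE lfunE. Qed.

Lemma mem_isotropy q a (f : dual (subvs_of a)) x :
  x \in isotropy q f <->
  x \in q /\ forall u : subvs_of a, f (vsproj a [lie x, vsval u]) = 0.
Proof.
rewrite memv_cap memv_ker lfunE; split.
  case/andP=> xq /eqP /= E; split=> // u.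
  by apply: oppr_inj; rewrite -coactE E zero_lfunE oppr0.
case=> -> E; apply/eqP/lfunP=> u /=.
by rewrite coactE E zero_lfunE oppr0.
Qed.

End LieAlgebraTheory.

(* Main.v *)
Require Import Defs.
(* Let W be the orthogonal of a for the Kirillov form of l, and c the
   codimension of the orbit of l|a. Then dim W = dim (g/a) + c, the stabilizer
   of l and a both lie in W, and their intersection annihilates g.(l|a), hence
   has dimension at most c. This gives
     dim g^l + dim a <= dim (g/a) + 2 c,
   with equality only if W = a + g^l, in which case l vanishes on the brackets
   of q(l|a). Conversely, W = q(l|a) + a is isotropic when q(l|a) is abelian,
   so that 2 dim W <= dim g + dim g^l, which is the reverse inequality.
   Finally, a generic l on the line joining a minimizer of dim g^l to a
   minimizer of c minimizes both. *)
From HB Require Import structures.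
From mathcomp Require Import all_boot all_order all_algebra.
From mathcomp Require Import boolp reals complex zify.

Set Implicit Arguments.
Unset Strict Implicit.
Unset Printing Implicit Defensive.

Import GRing.Theory Num.Theory VectorInternalTheory.
Local Open Scope ring_scope.

(** * Generic rank along a line of linear maps *)

Section GenericRank.
Variable K : numFieldType.

(** In characteristic zero the naturals below [size p] are distinct in [K], and there are more of
    them than a nonzero [p] can have roots. *)
Lemma exists_nat_nonroot (p : {poly K}) : p != 0 -> exists n, p.[n%:R] != 0.
Proof.
move=> p_neq0; apply: contrapT => no_nonroot.
pose s : seq K := [seq n%:R | n <- iota 0 (size p)].
have root_s : all (root p) s.
  apply/allP=> _ /mapP[n _ ->]; apply: contrapT => /negP nz.
  by apply: no_nonroot; exists n.
have uniq_s : uniq s.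
  by rewrite map_inj_uniq ?iota_uniq // => m n /eqP; rewrite eqr_nat => /eqP.
by have := max_poly_roots p_neq0 root_s uniq_s; rewrite size_map size_iota ltnn.
Qed.

(* If P (A + t0 B) Q = 1 witnesses the rank at t0, the polynomial is
   det (P (A + X B) Q), which takes the value 1 at t0. *)
Lemma mxrank_line_lower m n (A B : 'M[K]_(m, n)) (t0 : K) :
  exists2 p : {poly K}, p != 0 &
    forall t, p.[t] != 0 -> (\rank (A + t0 *: B)%R <= \rank (A + t *: B)%R)%N.
Proof.
pose P := pinvmx (col_base (A + t0 *: B)).
pose Q := pinvmx (row_base (A + t0 *: B)).
pose p := \det (map_mx polyC (P *m A *m Q) + 'X *: map_mx polyC (P *m B *m Q)).
have pE t : p.[t] = \det (P *m (A + t *: B) *m Q).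
  rewrite -[LHS]/(horner_eval t p) -det_map_mx; congr (\det _); apply/matrixP=> i j.
  rewrite mulmxDr mulmxDl -scalemxAr -scalemxAl.
  move: (P *m A *m Q) (P *m B *m Q) => C D.
  by rewrite !mxE /= /horner_eval hornerD hornerM hornerX !hornerC.
exists p => [|t].
  apply: contra_neq (oner_neq0 K) => p0; rewrite -(horner0 t0) -p0 pE.
  suff -> : P *m (A + t0 *: B) *m Q = 1%:M by rewrite det1.
  have -> : P *m (A + t0 *: B) = row_base (A + t0 *: B).
    have /(congr1 (mulmx P)) := mulmx_base (A + t0 *: B).
    by rewrite mulmxA mulVpmx ?col_base_full // mul1mx => <-.
  by rewrite mulmxVp ?row_base_free.
(* The invertible product has size the rank at [t0], and its rank is at most that of its middle
   factor. *)
rewrite pE -unitfE -unitmxE => /mxrank_unit rank_eq.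
apply: (@leq_trans (\rank (P *m (A + t *: B) *m Q))); first by rewrite rank_eq.
by rewrite (leq_trans (mxrankM_maxl _ _)) ?mxrankM_maxr.
Qed.

Lemma dim_limg_rank (V W : vectType K) (f : 'Hom(V, W)) :
  \dim (limg f) = \rank (f2mx f).
Proof. by rewrite unlock /dimv /= genmxE genmx1 mul1mx. Qed.

Lemma f2mx_line (V W : vectType K) (f h : 'Hom(V, W)) (t : K) :
  f2mx (f + t *: h) = f2mx f + t *: f2mx h.
Proof.
rewrite -[RHS]/(f2mx (Hom _)); congr f2mx; apply/lfunP=> v.
rewrite add_lfunE scale_lfunE; rewrite !unlock /=.
by rewrite mulmxDr -scalemxAr linearD linearZ.
Qed.

Lemma dim_limg_line_lower (V W : vectType K) (f h : 'Hom(V, W)) (t0 : K) :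
  exists2 p : {poly K}, p != 0 & forall t, p.[t] != 0 ->
    (\dim (limg (f + t0 *: h)%R) <= \dim (limg (f + t *: h)%R))%N.
Proof.
have [p p_neq0 p_rank] := mxrank_line_lower (f2mx f) (f2mx h) t0.
by exists p => // t /p_rank; rewrite !dim_limg_rank !f2mx_line.
Qed.

End GenericRank.

(** * Duals and annihilators *)

Lemma dim_dual (K : fieldType) (V : vectType K) : \dim {: dual V} = \dim {:V}.
Proof. by rewrite !dimvf /dim /= muln1. Qed.

Lemma dim_fullv_subvs (K : fieldType) (V : vectType K) (U : {vspace V}) :
  \dim {: subvs_of U} = \dim U.
Proof. by rewrite dimvf. Qed.

Section DualSpace.
Variables (K : fieldType) (V : vectType K).

Lemma dual_separates (v : V) : (forall m : dual V, m v = 0) -> v = 0.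
Proof.
move=> v0; rewrite (coord_vbasis (memvf v)) big1 // => i _.
have /= := v0 (linfun (coord (vbasis {:V}) i : V -> K^o)).
by rewrite lfunE /= => ->; rewrite scale0r.
Qed.

(** A form in [U] vanishes on [W], so its restriction to the complement [W^C] determines it. *)
Lemma dim_annihilator (U : {vspace dual V}) (W : {vspace V}) :
  (forall h w, h \in U -> w \in W -> h w = 0) -> (\dim U + \dim W <= \dim {:V})%N.
Proof.
move=> UW0.
pose res : dual V -> dual (subvs_of W^C) :=
  fun h => (h \o linfun (@vsval _ _ W^C))%VF.
have res_lin : linear res.
  by move=> k h h'; rewrite /res comp_lfunDl comp_lfunZl.
have resE := linfun_linearE res_lin.
have inj : (U :&: lker (linfun res) = 0)%VS.
  apply/eqP; rewrite -subv0; apply/subvP=> h; rewrite memv_cap memv_ker resE.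
  case/andP=> hU /eqP h0; rewrite memv0; apply/eqP/lfunP=> v.
  have: v \in (W + W^C)%VS by rewrite addv_complf memvf.
  case/memv_addP=> w wW [w' w'C ->].
  have := congr1 (fun k : dual (subvs_of W^C) => k (Subvs w'C)) h0.
  rewrite /res comp_lfunE lfunE !zero_lfunE /= => hw'.
  by rewrite [LHS]linearD /= UW0 ?hw' ?addr0.
rewrite -(limg_dim_eq inj).
have := dimvS (subvf (linfun res @: U)).
rewrite dim_dual dim_fullv_subvs dimv_compl.
by rewrite -(leq_add2r (\dim W)) subnK ?dimvS ?subvf.
Qed.

End DualSpace.

(** * Dimension bounds from the Kirillov form *)

Section IndexBound.
Variables (K : fieldType) (g : lieAlgType K).
Implicit Types (a q W : {vspace g}) (l : dual g).

Lemma lieDl (x y z : g) : [lie x + y, z] = [lie x, z] + [lie y, z].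
Proof. by have := lieb_linearl z 1 x y; rewrite !scale1r. Qed.

Lemma lieDr (x y z : g) : [lie z, x + y] = [lie z, x] + [lie z, y].
Proof. by have := lieb_linearr z 1 x y; rewrite !scale1r. Qed.

Lemma lie_anti (x y : g) : [lie x, y] = - [lie y, x].
Proof.
have := liebb (x + y); rewrite lieDl !lieDr !liebb add0r addr0 => /eqP.
by rewrite addr_eq0 => /eqP.
Qed.

Lemma dim_lie_stab l :
  (\dim (lie_stab l) + \dim (limg (kirillov l)) = \dim {:g})%N.
Proof. by rewrite -(limg_ker_dim (kirillov l) {:g}) capfv. Qed.

(* The orthogonal of a for the Kirillov form of any extension of f. *)
Definition polar a (f : dual (subvs_of a)) : {vspace g} :=
  lker (linfun (coact f)).

Lemma mem_polar a l x : is_ideal a ->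
  x \in polar (dual_restr a l) <-> forall u, u \in a -> l [lie x, u] = 0.
Proof.
move=> a_ideal; rewrite memv_ker lfunE /=; split=> [/eqP x0 u ua|x0].
  have := congr1 (fun h : dual (subvs_of a) => h (Subvs ua)) x0.
  rewrite coactE dual_restrE zero_lfunE /= vsprojK ?a_ideal //.
  by move/eqP; rewrite oppr_eq0 => /eqP.
apply/eqP/lfunP=> u; rewrite coactE dual_restrE zero_lfunE vsprojK.
  by rewrite x0 ?subvsP ?oppr0.
by rewrite a_ideal ?subvsP.
Qed.

Lemma dim_coorbit a (f : dual (subvs_of a)) :
  (codimv (coorbit f) + \dim (coorbit f) = \dim a)%N.
Proof.
rewrite /codimv subnK; last exact: dimvS (subvf _).
by rewrite dim_dual dim_fullv_subvs.
Qed.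

Lemma dim_codimv a : (codimv a + \dim a = \dim {:g})%N.
Proof. by rewrite /codimv subnK; last exact: dimvS (subvf _). Qed.

(** Rank-nullity for [coact f], with kernel [polar f] and image [coorbit f]. *)
Lemma dim_polar a (f : dual (subvs_of a)) :
  (\dim (polar f) = codimv a + codimv (coorbit f))%N.
Proof.
apply/eqP; rewrite -(eqn_add2r (\dim (coorbit f))) -addnA dim_coorbit.
by rewrite dim_codimv -(limg_ker_dim (linfun (coact f)) {:g}) capfv.
Qed.

(* If W is isotropic for the Kirillov form, its image in the dual of g
   annihilates W. *)
Lemma dim_kirillov_isotropic l W :
  (forall x y, x \in W -> y \in W -> l [lie x, y] = 0) ->
  (2 * \dim W <= \dim {:g} + \dim (lie_stab l))%N.
Proof.
move=> W0; rewrite mul2n -addnn -{1}(limg_ker_dim (kirillov l) W) -addnA addnC.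
apply: leq_add; last by rewrite dimvS ?capvSr.
apply: dim_annihilator => _ w /memv_imgP[x xW ->] wW.
by rewrite kirillovE W0.
Qed.

Section AbelianIdeal.
Variable a : {vspace g}.
Hypotheses (a_ideal : is_ideal a) (a_abelian : is_abelian a).

Lemma ideal_stab_sub_polar l : (a + lie_stab l <= polar (dual_restr a l))%VS.
Proof.
rewrite subv_add; apply/andP; split; apply/subvP=> x.
  by move=> xa; apply/mem_polar => // u ua; rewrite a_abelian ?linear0.
by move/mem_lie_stab=> x0; apply/mem_polar.
Qed.

(* a :&: lie_stab l is annihilated by the coadjoint orbit of the restriction
   of l to a. *)
Lemma dim_ideal_stab l :
  (\dim (lie_stab l) + \dim a
     <= \dim (a + lie_stab l) + codimv (coorbit (dual_restr a l)))%N.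
Proof.
set f := dual_restr a l.
(* [N] is a copy of [a :&: lie_stab l] inside [subvs_of a], where the forms of the orbit can be
   evaluated. *)
pose N := (linfun (vsproj a) @: (a :&: lie_stab l))%VS.
have dimN : \dim N = \dim (a :&: lie_stab l).
  apply: limg_dim_eq; apply/eqP; rewrite -subv0; apply/subvP=> x.
  rewrite !memv_cap memv_ker lfunE memv0 /= => /andP[/andP[xa _] /eqP x0].
  by rewrite -(vsprojK xa) x0 linear0.
rewrite [X in (X <= _)%N]addnC -dimv_sum_cap leq_add2l -dimN.
rewrite -(leq_add2r (\dim (coorbit f))) dim_coorbit addnC -(dim_fullv_subvs a).
apply: dim_annihilator => h v /mem_coorbit[x ->] /memv_imgP[u + ->].
rewrite memv_cap => /andP[ua /mem_lie_stab u0].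
by rewrite lfunE /= coactE dual_restrE !vsprojK ?a_ideal // lie_anti raddfN /= u0 !oppr0.
Qed.

Lemma dim_lie_stab_le l :
  (\dim (lie_stab l) + \dim a
     <= codimv a + 2 * codimv (coorbit (dual_restr a l)))%N.
Proof.
have := dim_ideal_stab l; have := dimvS (ideal_stab_sub_polar l).
by rewrite dim_polar; lia.
Qed.

(** Equality in [dim_lie_stab_le] leaves no gap of dimension in the inclusion
    [ideal_stab_sub_polar]. *)
Lemma polar_eq_ideal_stab l :
  (\dim (lie_stab l) + \dim a
     = codimv a + 2 * codimv (coorbit (dual_restr a l)))%N ->
  polar (dual_restr a l) = (a + lie_stab l)%VS.
Proof.
move=> ext; apply/esym/eqP; rewrite eqEdim ideal_stab_sub_polar.
by have := dim_ideal_stab l; rewrite dim_polar ext; lia.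
Qed.

(** * Isotropy in a complement of the ideal *)

Section Complement.
Variable q : {vspace g}.
Hypothesis g_sum : (q + a)%VS = {:g}%VS.

Lemma isotropy_polar l x : x \in isotropy q (dual_restr a l) ->
  x \in q /\ forall u, u \in a -> l [lie x, u] = 0.
Proof. by rewrite memv_cap => /andP[xq xl]; split=> //; apply/mem_polar. Qed.

Lemma dim_lie_stab_eq l : is_abelian (isotropy q (dual_restr a l)) ->
  (\dim (lie_stab l) + \dim a
     = codimv a + 2 * codimv (coorbit (dual_restr a l)))%N.
Proof.
move=> iso_abelian; apply/eqP; rewrite eqn_leq dim_lie_stab_le /=.
pose W := polar (dual_restr a l).
have /dim_kirillov_isotropic : forall x y, x \in W -> y \in W -> l [lie x, y] = 0.
  move=> x y xW yW.
  (* As [a] lies in [W], the [q]-component of an element of [W] is again in [W], hence in the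
     isotropy; only brackets with [a] remain, and [l] kills those. *)
  have [xq xqq [xa xaa xE]] : exists2 xq, xq \in q & exists2 xa, xa \in a & x = xq + xa.
    by apply/memv_addP; rewrite g_sum memvf.
  have [yq yqq [ya yaa yE]] : exists2 yq, yq \in q & exists2 ya, ya \in a & y = yq + ya.
    by apply/memv_addP; rewrite g_sum memvf.
  have aW u : u \in a -> u \in W.
    by move=> ua; apply: (subvP (ideal_stab_sub_polar l)); apply: (subvP (addvSl _ _)).
  have l_a z u : z \in W -> u \in a -> l [lie z, u] = 0.
    by move=> zW ua; apply: (mem_polar l z a_ideal).1.
  have q_iso z u : z + u \in W -> u \in a -> z \in q ->
      z \in isotropy q (dual_restr a l).
    move=> zuW ua zq; rewrite memv_cap zq /= -/(polar _) -/W.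
    by rewrite -(addrK u z) (rpredB zuW (aW u ua)).
  rewrite lie_anti {1}xE lieDr opprD [l _]linearB /= (l_a y xa) // subr0 -lie_anti.
  rewrite yE lieDr iso_abelian ?add0r; last first.
  - by apply: (q_iso _ ya); rewrite -?yE.
  - by apply: (q_iso _ xa); rewrite -?xE.
  by apply: l_a => //; rewrite -(addrK xa xq) -xE (rpredB xW (aW xa xaa)).
by rewrite dim_polar -(dim_codimv a); lia.
Qed.

Hypotheses (q_subalg : is_subalg q) (g_direct : directv (q + a)%VS).

(* Only the restriction of l to a enters the dimension, so the values of l on
   q can be prescribed freely. *)
Lemma isotropy_abelian l :
  (forall l', dual_restr a l' = dual_restr a l ->
     (\dim (lie_stab l') + \dim a
        = codimv a + 2 * codimv (coorbit (dual_restr a l')))%N) ->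
  is_abelian (isotropy q (dual_restr a l)).
Proof.
have qa0 : (q :&: a = 0)%VS by apply/directv_addP.
have aq0 : (a :&: q = 0)%VS by rewrite capvC.
have pi_q v : v \in q -> daddv_pi q a v = v by apply: daddv_pi_id.
have pi_aq v : v \in q -> daddv_pi a q v = 0.
  move=> vq; have := @daddv_pi_add _ _ _ _ v qa0.
  by rewrite g_sum memvf pi_q // => /(_ isT)/eqP; rewrite addrC -subr_eq0 addrK => /eqP.
have pi_a v : v \in a -> daddv_pi a q v = v by apply: daddv_pi_id.
have pi_qa v : v \in a -> daddv_pi q a v = 0.
  move=> va; have := @daddv_pi_add _ _ _ _ v qa0.
  by rewrite g_sum memvf pi_a // => /(_ isT)/eqP; rewrite -subr_eq0 addrK => /eqP.
move=> ext x y xI yI.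
have [xq _] := isotropy_polar xI; have [yq y_a] := isotropy_polar yI.
apply: dual_separates => m.
(* [l'] equals [l] on [a] and the test form [m] on [q]; since [[lie x, y]] is in [q], [m] may be
   replaced by [l'] there. *)
pose l' : dual g := (l \o daddv_pi a q)%VF + (m \o daddv_pi q a)%VF.
have l'_a v : v \in a -> l' v = l v.
  by move=> va; rewrite add_lfunE !comp_lfunE pi_a ?pi_qa // linear0 addr0.
have l'_q v : v \in q -> l' v = m v.
  by move=> vq; rewrite add_lfunE !comp_lfunE pi_aq ?pi_q // linear0 add0r.
have restr_eq : dual_restr a l' = dual_restr a l.
  by apply/lfunP=> u; rewrite !dual_restrE l'_a ?subvsP.
rewrite -l'_q ?q_subalg //.
have : x \in (a + lie_stab l')%VS.
  rewrite -polar_eq_ideal_stab ?ext // restr_eq.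
  by move: xI; rewrite memv_cap => /andP[].
(* The part [z] of [x] stabilizes [l']; the part [u] pairs to zero with [y] because [y] is in the
   isotropy. *)
case/memv_addP=> u ua [z /mem_lie_stab z0 ->].
rewrite lieDl linearD /= z0 addr0 lie_anti l'_a ?rpredN ?a_ideal //.
by rewrite raddfN /= y_a ?oppr0.
Qed.

End Complement.

End AbelianIdeal.

End IndexBound.

(** * Simultaneous minimizers *)

Section GenericForm.
Variables (K : numFieldType) (g : lieAlgType K) (a : {vspace g}).

Lemma kirillov_line (l h : dual g) (t : K) :
  kirillov (l + t *: h) = kirillov l + t *: kirillov h.
Proof.
apply/lfunP=> x; apply/lfunP=> y.
by rewrite !(add_lfunE, scale_lfunE, kirillovE).
Qed.

Lemma coact_restr_line (l h : dual g) (t : K) :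
  linfun (coact (dual_restr a (l + t *: h)))
  = linfun (coact (dual_restr a l)) + t *: linfun (coact (dual_restr a h)).
Proof.
apply/lfunP=> x; rewrite add_lfunE scale_lfunE !lfunE /=; apply/lfunP=> u.
rewrite !(add_lfunE, scale_lfunE, coactE, dual_restrE).
by rewrite opprD scalerN.
Qed.

(* Both dimensions are minimal on nonempty Zariski open sets, which meet on
   the line through l1 and l2. *)
Lemma exists_generic_form (l1 l2 : dual g) : exists l : dual g,
  (\dim (lie_stab l) <= \dim (lie_stab l1))%N /\
  (codimv (coorbit (dual_restr a l)) <= codimv (coorbit (dual_restr a l2)))%N.
Proof.
pose h := l2 - l1.
(* On the line [l1 + t *: h], parameter 0 is [l1] and parameter 1 is [l2]. *)
have [p1 p1_neq0 p1P] := dim_limg_line_lower (kirillov l1) (kirillov h) 0.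
have [p2 p2_neq0 p2P] := dim_limg_line_lower
  (linfun (coact (dual_restr a l1))) (linfun (coact (dual_restr a h))) 1.
have [n] := exists_nat_nonroot (mulf_neq0 p1_neq0 p2_neq0).
rewrite hornerM mulf_eq0 negb_or => /andP[/p1P le1 /p2P le2].
exists (l1 + n%:R *: h); split.
  move: le1; rewrite -!kirillov_line scale0r addr0.
  rewrite -(leq_add2l (\dim (lie_stab l1))) dim_lie_stab.
  by rewrite -(dim_lie_stab (l1 + n%:R *: h)) leq_add2r.
move: le2; rewrite -!coact_restr_line scale1r [l1 + h]addrC subrK => le2.
exact: leq_sub2l.
Qed.

End GenericForm.

(** * The equivalence *)

Lemma index_eq_iff_isotropy_abelian (K : numFieldType) (g : lieAlgType K) (a q : {vspace g})
    (a_ideal : is_ideal a) (a_abelian : is_abelian a) (q_subalg : is_subalg q)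
    (g_sum : (q + a)%VS = {:g}%VS) (g_direct : directv (q + a)%VS) :
  (lie_index g + \dim a = codimv a + 2 * rel_index a)%N
  <->
  (forall l : dual g,
     codimv (coorbit (dual_restr a l)) = rel_index a ->
     is_abelian (isotropy q (dual_restr a l))).
Proof.
have [[l1 l1E] l1_min] := min_valP (fun l : dual g => \dim (lie_stab l)).
have [[f fE] f_min] := min_valP (fun f : dual (subvs_of a) => codimv (coorbit f)).
rewrite -/(lie_index g) /= in l1E l1_min.
rewrite -/(rel_index a) /= in fE f_min.
split=> [idx l l_gen|all_abelian].
  apply: (isotropy_abelian a_ideal a_abelian g_sum q_subalg g_direct) => l' l'E.
  (* One inequality is the general bound; the other follows from [idx] and the minimality of the
     index. *)
  apply/eqP; rewrite eqn_leq dim_lie_stab_le //=.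
  by rewrite l'E l_gen -idx leq_add2r l1_min.
(* [l2] extends the minimizer [f] from [a] to the whole algebra. *)
pose l2 : dual g := (f \o linfun (vsproj a))%VF.
have l2E : dual_restr a l2 = f.
  by apply/lfunP=> u; rewrite dual_restrE comp_lfunE lfunE /= vsvalK.
have [l []] := exists_generic_form a l1 l2.
rewrite l1E l2E fE => l_stab l_orb.
have {}l_orb : codimv (coorbit (dual_restr a l)) = rel_index a.
  by apply/eqP; rewrite eqn_leq l_orb f_min.
have {}l_stab : \dim (lie_stab l) = lie_index g.
  by apply/eqP; rewrite eqn_leq l_stab l1_min.
rewrite -l_stab -l_orb.
exact: (dim_lie_stab_eq a_ideal a_abelian g_sum (all_abelian l l_orb)).
Qed.

Theorem mainTheorem3 (R : realType) (g : lieAlgType R[i]) (a q : {vspace g})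
    (a_ideal : is_ideal a) (a_abelian : is_abelian a) (q_subalg : is_subalg q)
    (g_sum : (q + a)%VS = {:g}%VS) (g_direct : directv (q + a)%VS) :
  (lie_index g + \dim a = codimv a + 2 * rel_index a)%N
  <->
  (forall l : dual g,
     codimv (coorbit (dual_restr a l)) = rel_index a ->
     is_abelian (isotropy q (dual_restr a l))).
Proof. exact: index_eq_iff_isotropy_abelian. Qed.
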